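(* Let $G$ be a graph on $n$ vertices and let $V(G)=V_1\cup V_2$ be any partition with $|V_1|=\lceil n/2\rceil$ and $|V_2|=\lfloor n/2\rfloor$. Say that $(G,V_1,V_2)$ has a colorful bi-clique of size $2m$ if there are sets $A\subseteq V_1$, $B\subseteq V_2$ with $|A|=|B|=m$ such that either every vertex of $A$ is adjacent in $G$ to every vertex of $B$, or no vertex of $A$ is adjacent in $G$ to any vertex of $B$. Then: (1) If $G$ is an interval graph, then $(G,V_1,V_2)$ has a colorful bi-clique of size $2\lfloor \tfrac{1}{3}\cdot\tfrac{n}{2}\rfloor$. (2) If $G$ is a cograph, then $(G,V_1,V_2)$ has a colorful bi-clique of size $2\lfloor \tfrac{1}{4}\cdot\tfrac{n}{2}\rfloor$. (3) For every integer $k\ge 2$, if $G\in\mathcal{T}_k$, then $(G,V_1,V_2)$ has a colorful bi-clique of size $2\lfloor \tfrac{\ln k}{20k}\cdot\tfrac{n}{2}\rfloor$.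
   Context: All graphs are finite and simple. An interval graph is the intersection graph of a finite family of intervals on the real line. A cograph is a graph obtainable from a single vertex by repeatedly taking complements and disjoint unions (equivalently, with no induced path on four vertices). A chordal graph is the intersection graph of a finite family of subtrees of some tree (the ambient tree); such a family is a subtree representation. The leafage $\ell(G)$ of a chordal graph $G$ is the minimum number of leaves of an ambient tree over all subtree representations of $G$. For an integer $k\ge2$, $\mathcal{T}_k$ is the class of chordal graphs $G$ with $\ell(G)\le k$. In the paper's language these classes have the colorful Erdős–Hajnal property with constants $1/3$, $1/4$, $\ln k/(20k)$ respectively. *)

(* Defs.v *)
From HB Require Import structures.
From mathcomp Require Import all_boot all_order all_algebra.
From mathcomp Require Import boolp reals exp.

Set Implicit Arguments.
Unset Strict Implicit.
Unset Printing Implicit Defensive.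

Record sgraph := SGraph {
  vertex :> finType;
  edge : rel vertex;
  edge_sym : symmetric edge;
  edge_irr : irreflexive edge }.

Arguments edge {s}.

Definition sg_iso (G H : sgraph) : Prop :=
  exists f : G -> H, bijective f /\ forall u v, edge (f u) (f v) = edge u v.

(* [interval R] covers open, closed, half-open and unbounded intervals. *)
Definition interval_graph (R : realType) (G : sgraph) : Prop :=
  exists I : G -> interval R, forall u v : G, u != v ->
    (edge u v <-> exists x : R, x \in I u /\ x \in I v).

Definition compl_edge (G : sgraph) : rel G :=
  fun u v => (u != v) && ~~ edge u v.

Lemma compl_edge_sym (G : sgraph) : symmetric (@compl_edge G).
Proof. by move=> u v; rewrite /compl_edge eq_sym edge_sym. Qed.

Lemma compl_edge_irr (G : sgraph) : irreflexive (@compl_edge G).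
Proof. by move=> u; rewrite /compl_edge eqxx. Qed.

Definition sg_compl (G : sgraph) : sgraph :=
  SGraph (@compl_edge_sym G) (@compl_edge_irr G).

Definition union_edge (G H : sgraph) : rel (G + H)%type := fun x y =>
  match x, y with
  | inl u, inl v => edge u v
  | inr u, inr v => edge u v
  | _, _ => false
  end.

Lemma union_edge_sym (G H : sgraph) : symmetric (@union_edge G H).
Proof. by move=> [u|u] [v|v] //=; rewrite edge_sym. Qed.

Lemma union_edge_irr (G H : sgraph) : irreflexive (@union_edge G H).
Proof. by move=> [u|u] /=; rewrite edge_irr. Qed.

Definition sg_union (G H : sgraph) : sgraph :=
  SGraph (@union_edge_sym G H) (@union_edge_irr G H).

Inductive cograph : sgraph -> Prop :=
| cograph_single (G : sgraph) : #|G| = 1 -> cograph G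
| cograph_compl (G : sgraph) : cograph G -> cograph (sg_compl G)
| cograph_union (G H : sgraph) :
    cograph G -> cograph H -> cograph (sg_union G H)
| cograph_iso (G H : sgraph) : sg_iso G H -> cograph G -> cograph H.

Definition sg_connected (G : sgraph) : Prop :=
  0 < #|G| /\ forall x y : G, connect edge x y.

(* The size condition is needed because [ucycle] accepts [:: x; y] for an
   edge xy. *)
Definition sg_acyclic (G : sgraph) : Prop :=
  forall c : seq G, 2 < size c -> ~ ucycle edge c.

Definition is_tree (T : sgraph) : Prop := sg_connected T /\ sg_acyclic T.

(* The one-vertex tree has no leaf. *)
Definition leaves (T : sgraph) : {set T} :=
  [set x : T | #|[set y : T | edge x y]| == 1].

(* A subtree is identified with its vertex set. *)
Definition is_subtree (T : sgraph) (S : {set T}) : Prop :=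
  S != set0 /\
  {in S &, forall x y,
     connect [rel u v : T | [&& u \in S, v \in S & edge u v]] x y}.

Definition subtree_rep (G T : sgraph) (S : G -> {set T}) : Prop :=
  (forall u, is_subtree (S u)) /\
  (forall u v, u != v -> edge u v = (S u :&: S v != set0)).

Definition rep_with_leaves (G : sgraph) (l : nat) : Prop :=
  exists T : sgraph,
    [/\ is_tree T, #|leaves T| = l & exists S : G -> {set T}, subtree_rep S].

Definition chordal (G : sgraph) : Prop :=
  exists T : sgraph, is_tree T /\ exists S : G -> {set T}, subtree_rep S.

Lemma chordal_leaves (G : sgraph) :
  chordal G -> exists l, `[< rep_with_leaves G l >].
Proof.
by move=> [T [treeT repS]]; exists #|leaves T|; apply/asboolP; exists T.
Qed.

Definition leafage (G : sgraph) (chG : chordal G) : nat :=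
  ex_minn (chordal_leaves chG).

Definition leafage_class (k : nat) (G : sgraph) : Prop :=
  exists chG : chordal G, leafage chG <= k.

(* [colorful_biclique V1 V2 m] is a colorful bi-clique of size 2m. *)
Definition colorful_biclique (G : sgraph) (V1 V2 : {set G}) (m : nat) : Prop :=
  exists A B : {set G},
    [/\ A \subset V1, B \subset V2, #|A| = m, #|B| = m &
        {in A & B, forall x y, edge x y} \/
        {in A & B, forall x y, ~~ edge x y}].

(* Main.v *)
(* Interval graphs: if A consists of the m intervals of V1 that end first, before
   or at p, and B of the m that begin last, from q on, then either m intervals of
   V2 miss A or B, or at least m intervals of V2 begin before p and end after q;
   these meet all intervals of V1 outside A and B, which end after p and begin
   before q.

   Cographs: every vertex set with two elements splits into two parts that are
   complete or anticomplete to each other. Follow the larger part, collecting the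
   small parts split off according to their type, until m of them have the same
   colour and type.

   Leafage: unless there is an anticomplete pair, some vertex x of the tree lies
   in almost all subtrees of one colour, say V1. Rooted at x, such a subtree meets
   a subtree of V2 iff it contains its top, and the tops lie on at most k chains
   from x to the leaves, of which each subtree through x cuts off initial
   segments. Cutting the chains into about 3k blocks of t consecutive tops, every
   such subtree contains or avoids all but k blocks. Hence averaging, which costs
   a factor of 4 per block, finds about log k blocks that are simultaneously
   contained in, or avoided by, m subtrees. *)
Require Import Defs.
From HB Require Import structures.
From mathcomp Require Import all_boot all_order all_algebra.
From mathcomp Require Import boolp reals exp.
From mathcomp Require Import zify lra ring.

Set Implicit Arguments.
Unset Strict Implicit.
Unset Printing Implicit Defensive.

Import Order.TTheory GRing.Theory Num.Theory.

(** * Subsets of prescribed size and reductions for bi-cliques *)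

Lemma subset_of_card (T : finType) (X : {set T}) m :
  m <= #|X| -> exists2 A : {set T}, A \subset X & #|A| = m.
Proof.
move=> mX; exists [set x in take m (enum X)].
  by apply/subsetP => x; rewrite inE => /mem_take; rewrite mem_enum.
rewrite cardsE (card_uniqP _) ?take_uniq ?enum_uniq // size_take -cardE.
by case: ltngtP mX.
Qed.

Lemma initial_segment (T : finType) (le : rel T) (X : {set T}) t :
  total le -> transitive le -> t <= #|X| ->
  exists A : {set T},
    [/\ A \subset X, #|A| = t & {in A & X :\: A, forall a b, le a b}].
Proof.
move=> le_total le_trans tX; set s := sort le (enum X).
have s_uniq : uniq s by rewrite sort_uniq enum_uniq.
have mem_s x : (x \in s) = (x \in X) by rewrite mem_sort mem_enum.
have : pairwise le s by rewrite -sorted_pairwise // sort_sorted.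
rewrite -{1}(cat_take_drop t s) pairwise_cat => /and3P[/allrelP le_s _ _].
exists [set x in take t s]; split.
- by apply/subsetP => x; rewrite inE => /mem_take; rewrite mem_s.
- rewrite cardsE (card_uniqP _) ?take_uniq // size_take size_sort -cardE.
  by case: ltngtP tX.
- move=> x y; rewrite !inE => xs /andP[ys yX]; apply: le_s => //.
  by move: yX; rewrite -mem_s -{1}(cat_take_drop t s) mem_cat (negPf ys).
Qed.

Lemma colorful_of_large (G : sgraph) (V1 V2 A B : {set G}) m :
    A \subset V1 -> B \subset V2 -> m <= #|A| -> m <= #|B| ->
    {in A & B, forall x y, edge x y} \/ {in A & B, forall x y, ~~ edge x y} ->
  colorful_biclique V1 V2 m.
Proof.
move=> AV BV /subset_of_card[A' A'A cA'] /subset_of_card[B' B'B cB'] AB.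
exists A', B'; split=> //; [exact: subset_trans AV|exact: subset_trans BV|].
by case: AB => AB; [left|right] => x y /(subsetP A'A) ? /(subsetP B'B) ?;
  apply: AB.
Qed.

Lemma colorful0 (G : sgraph) (V1 V2 : {set G}) : colorful_biclique V1 V2 0.
Proof.
exists set0, set0; split; rewrite ?sub0set ?cards0 //.
by left=> x y; rewrite inE.
Qed.

Lemma colorful_sym (G : sgraph) (V1 V2 : {set G}) m :
  colorful_biclique V1 V2 m -> colorful_biclique V2 V1 m.
Proof.
case=> A [B [AV BV cA cB AB]]; exists B, A; split=> //.
by case: AB => AB; [left|right] => x y xB yA; rewrite edge_sym AB.
Qed.

(** * Interval graphs *)

Section IntervalOrders.
Variable (d : Order.disp_t) (O : orderType d).
Local Open Scope order_scope.

(** The order is abstract so that it can be [itv_bound R], which tells open ends from closed ones;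
    strict comparison of bounds then expresses intersection for every kind of interval. *)
Lemma interval_order_biclique (G : sgraph) (V1 V2 : {set G}) (l r : G -> O) m :
    (forall u v, u \in V1 -> v \in V2 -> edge u v = (l u < r v) && (l v < r u)) ->
    (3 * m <= #|V1|)%N -> (3 * m <= #|V2|)%N ->
  colorful_biclique V1 V2 m.
Proof.
move=> edgeE mV1 mV2; have [->|m_gt0] := posnP m.
  exact: colorful0.
have mV1' : (m <= #|V1|)%N by lia.
have [A [AV cA leA]] : exists A : {set G}, [/\ A \subset V1, #|A| = m &
    {in A & V1 :\: A, forall a b, r a <= r b}].
  by apply: initial_segment => // [x y|x y z]; [apply: le_total|apply: le_trans].
have [B [BV cB leB]] : exists B : {set G}, [/\ B \subset V1, #|B| = m &
    {in B & V1 :\: B, forall a b, l b <= l a}].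
  by apply: initial_segment => // [x y|x y z xy yz];
    [apply: le_total|apply: le_trans yz xy].
have [a0 a0A] : exists a, a \in A by apply/card_gt0P; rewrite cA.
have [b0 b0B] : exists b, b \in B by apply/card_gt0P; rewrite cB.
case: (Order.TotalTheory.arg_maxP r a0A) => a aA maxa.
case: (Order.TotalTheory.arg_minP l b0B) => b bB minb.
have [X1|X1] := leqP m #|[set v in V2 | r a <= l v]|.
  apply: (colorful_of_large AV _ _ X1); rewrite ?cA //.
    by apply/subsetP => v; rewrite inE => /andP[].
  right=> u v uA; rewrite inE => /andP[vV rlv].
  rewrite edgeE ?(subsetP AV) // negb_and orbC -leNgt.
  by rewrite (le_trans (maxa _ uA)).
have [X2|X2] := leqP m #|[set v in V2 | r v <= l b]|.
  apply: (colorful_of_large BV _ _ X2); rewrite ?cB //.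
    by apply/subsetP => v; rewrite inE => /andP[].
  right=> u v uB; rewrite inE => /andP[vV rlv].
  rewrite edgeE ?(subsetP BV) // negb_and -leNgt.
  by rewrite (le_trans rlv (minb _ uB)).
(* [A] and [B] both lie in [V1], so at least [3m - 2m] of it remains; [V2] loses two sets of fewer
   than [m] elements. *)
apply: (@colorful_of_large _ _ _ (V1 :\: (A :|: B))
   (V2 :\: ([set v in V2 | r a <= l v] :|: [set v in V2 | r v <= l b]))).
- exact: subsetDl.
- exact: subsetDl.
- have [+ _] := leq_card_setU A B; have := cardsID (A :|: B) V1.
  have := subset_leq_card (subsetIr V1 (A :|: B)); lia.
- have [+ _] := leq_card_setU [set v in V2 | r a <= l v] [set v in V2 | r v <= l b].
  set U := _ :|: _; have := cardsID U V2.
  have := subset_leq_card (subsetIr V2 U); lia.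
left=> u v; rewrite !inE => /andP[/norP[uA uB] uV] /andP[+ vV].
rewrite vV /= => /norP[]; rewrite -!ltNge => lva lrv.
rewrite edgeE //; apply/andP; split.
  by apply: le_lt_trans lrv; apply: leB; rewrite ?inE ?uB.
by apply: lt_le_trans lva _; apply: leA; rewrite ?inE ?uA.
Qed.

End IntervalOrders.

Section RealIntervals.
Variable R : realType.
Local Open Scope ring_scope.

(** The point is a closed end if there is one; otherwise the midpoint of two finite ends, a shift by
    1 of the only finite end, or 0. *)
Lemma itv_bound_between (b c : itv_bound R) :
  (b < c)%O -> exists x : R, (b <= BLeft x)%O && (BRight x <= c)%O.
Proof.
case: b c => [[] x|[]] [[] y|[]] //; rewrite ?bnd_simp => xy.
- by exists x; rewrite !bnd_simp ?lexx.
- by exists x; rewrite !bnd_simp ?lexx.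
- by exists x; rewrite !bnd_simp ?lexx.
- by exists ((x + y) / 2); have := midf_lt xy; rewrite !bnd_simp => -[-> ->].
- by exists y; rewrite !bnd_simp ?lexx xy.
- by exists (x + 1); rewrite !bnd_simp ltrDl ltr01.
- by exists (y - 1); rewrite !bnd_simp ltrBlDr ltrDl ltr01.
- by exists y; rewrite !bnd_simp ?lexx.
- by exists 0; rewrite !bnd_simp.
Qed.

Lemma interval_biclique (G : sgraph) (V1 V2 : {set G}) m :
    [disjoint V1 & V2] -> interval_graph R G ->
    (3 * m <= #|V1|)%N -> (3 * m <= #|V2|)%N ->
  colorful_biclique V1 V2 m.
Proof.
move=> V12 [I edgeI].
pose lo u := let: Interval b _ := I u in b.
pose hi u := let: Interval _ c := I u in c.
have memI (x : R) u : (x \in I u) = (lo u <= BLeft x)%O && (BRight x <= hi u)%O.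
  by rewrite /lo /hi; case: (I u) => b c; rewrite itv_boundlr.
(* Empty intervals get bounds that are adjacent to nothing. *)
pose l u : itv_bound R := if (lo u < hi u)%O then lo u else +oo%O.
pose r u : itv_bound R := if (lo u < hi u)%O then hi u else -oo%O.
apply: (@interval_order_biclique _ _ _ _ _ l r) => u v uV vV.
have uv : u != v.
  by apply/eqP => uv; move/disjointFr: V12 => /(_ u uV); rewrite uv vV.
apply/idP/idP => [/(edgeI _ _ uv)[x []]|].
  rewrite !memI => /andP[lu hu] /andP[lv hv].
  have lr : (BLeft x < BRight x :> itv_bound R)%O by rewrite bnd_simp.
  have lh w w' : (lo w <= BLeft x)%O -> (BRight x <= hi w')%O -> (lo w < hi w')%O.
    by move=> lw hw; apply: le_lt_trans lw (lt_le_trans lr hw).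
  by rewrite /l /r !lh.
rewrite /l /r; case: ifP => ulh; case: ifP => vlh; rewrite ?bnd_simp ?andbF //.
case/andP=> uv' vu'; apply/(edgeI _ _ uv).
(* Two intervals meet as soon as the larger lower bound is below the smaller upper bound. *)
have /itv_bound_between[x] :
    (Order.max (lo u) (lo v) < Order.min (hi u) (hi v))%O.
  by rewrite lt_min !gt_max ulh vlh uv' vu'.
rewrite le_min ge_max => /andP[/andP[? ?] /andP[? ?]].
by exists x; rewrite !memI; split; apply/andP.
Qed.

End RealIntervals.

(** * Cographs *)

Definition homogeneous (G : sgraph) (A B : {set G}) (b : bool) :=
  {in A & B, forall x y, edge x y = b}.

(** With [b = false], [X] induces a disconnected subgraph; with [b = true], the complement of that
    subgraph is disconnected. *)
Definition splits (G : sgraph) (X : {set G}) :=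
  exists X1 X2 : {set G}, exists b : bool,
    [/\ X1 != set0, X2 != set0, X = X1 :|: X2, [disjoint X1 & X2] &
        homogeneous X1 X2 b].

Lemma splits_imset (G H : sgraph) (f : G -> H) (X : {set G}) :
    injective f -> (forall u v, edge (f u) (f v) = edge u v) ->
  splits X -> splits (f @: X).
Proof.
move=> finj edgef [X1 [X2 [b [X1n0 X2n0 -> X12 hom]]]].
exists (f @: X1), (f @: X2), b; split.
- by rewrite imset_eq0.
- by rewrite imset_eq0.
- by rewrite imsetU.
- by rewrite -setI_eq0 -imsetI ?(disjoint_setI0 X12) ?imset0 // => x y _ _ /finj.
- by move=> _ _ /imsetP[x xX ->] /imsetP[y yX ->]; rewrite edgef hom.
Qed.

(** Induction on the construction, for all [X] at once: a complement flips [b]; in a union, [X] lies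
    in one summand or is split by the two with [b = false]. *)
Lemma cograph_splits (G : sgraph) :
  cograph G -> forall X : {set G}, 1 < #|X| -> splits X.
Proof.
elim=> {G} [G G1|G _ IH|G H _ IHG _ IHH|G H [f [fbij edgef]] _ IH] X X2.
- by have := leq_trans X2 (max_card X); rewrite G1.
- have [X1 [X3 [b [X1n0 X3n0 -> X13 hom]]]] := IH X X2.
  exists X1, X3, (~~ b); split=> // x y xX yX; rewrite /= /compl_edge (hom x y) //.
  by rewrite (_ : x != y) //; apply: contraTneq yX => <-; rewrite (disjointFr X13).
- have [[x xX]|] := pselect (exists x, inl x \in X); last first.
    move=> Xl; have XE : X = inr @: (inr @^-1: X).
      apply/setP => -[x|y].
        by apply/idP/imsetP => [xX|[? ? //]]; case: Xl; exists x.
      by rewrite mem_imset ?inE // => ? ? [].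
    rewrite XE; apply: (@splits_imset H (sg_union G H) inr) => // [? ? []//|].
    by apply: IHH; move: X2; rewrite {1}XE card_imset // => ? ? [].
  have [[y yX]|] := pselect (exists x, inr x \in X); last first.
    move=> Xr; have XE : X = inl @: (inl @^-1: X).
      apply/setP => -[z|y]; last first.
        by apply/idP/imsetP => [yX|[? ? //]]; case: Xr; exists y.
      by rewrite mem_imset ?inE // => ? ? [].
    rewrite XE; apply: (@splits_imset G (sg_union G H) inl) => // [? ? []//|].
    by apply: IHG; move: X2; rewrite {1}XE card_imset // => ? ? [].
  exists (inl @: (inl @^-1: X)), (inr @: (inr @^-1: X)), false; split.
  + by apply/set0Pn; exists (inl x); rewrite mem_imset ?inE // => ? ? [].
  + by apply/set0Pn; exists (inr y); rewrite mem_imset ?inE // => ? ? [].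
  + apply/setP => -[z|z]; rewrite inE; apply/idP/orP.
    * by left; rewrite mem_imset ?inE // => ? ? [].
    * by case=> /imsetP[z' +] // [->]; rewrite inE.
    * by right; rewrite mem_imset ?inE // => ? ? [].
    * by case=> /imsetP[z' +] // [->]; rewrite inE.
  + rewrite -setI_eq0; apply/eqP/setP => z; rewrite !inE.
    by apply/negP => /andP[/imsetP[? _ ->] /imsetP[? _]].
  + by move=> _ _ /imsetP[z _ ->] /imsetP[w _ ->].
- case: (fbij) => g gf fg; rewrite (_ : X = f @: (g @: X)).
    apply: splits_imset => //; first exact: bij_inj fbij.
    by apply: IH; rewrite card_imset //; apply: can_inj fg.
  by rewrite -imset_comp (eq_imset _ (g := id)) ?imset_id.
Qed.

Lemma homogeneous_biclique (G : sgraph) (V1 V2 A B : {set G}) b m :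
    A \subset V1 -> B \subset V2 -> m <= #|A| -> m <= #|B| ->
  homogeneous A B b -> colorful_biclique V1 V2 m.
Proof.
move=> AV BV mA mB AB; apply: (colorful_of_large AV BV mA mB).
by case: b AB => AB; [left|right] => x y xA yB; rewrite AB.
Qed.

Lemma homogeneous_sym (G : sgraph) (A B : {set G}) b :
  homogeneous A B b -> homogeneous B A b.
Proof. by move=> AB x y xB yA; rewrite edge_sym AB. Qed.

Lemma card_cover3 (T : finType) (V X Y Z : {set T}) :
  X :|: Y :|: Z = setT -> #|V| <= #|X :&: V| + #|Y :&: V| + #|Z :&: V|.
Proof.
move=> XYZ; rewrite -{1}[V]setTI -XYZ !setIUl.
have [+ _] := leq_card_setU (X :&: V :|: Y :&: V) (Z :&: V).
have [+ _] := leq_card_setU (X :&: V) (Y :&: V); lia.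
Qed.

Section CographDescent.
Variables (G : sgraph) (V1 V2 : {set G}) (m : nat).
Hypothesis splitsG : forall X : {set G}, 1 < #|X| -> splits X.
Hypotheses (mV1 : 4 * m <= #|V1|) (mV2 : 4 * m <= #|V2|).

Let small (X : {set G}) := (#|X :&: V1| < m) && (#|X :&: V2| < m).

(* [Y true] and [Y false] collect the parts split off so far that are complete,
   respectively anticomplete, to the current part [X]. *)
Lemma cograph_descent n (X : {set G}) (Y : bool -> {set G}) :
    #|X| <= n -> (forall b, small (Y b)) -> (forall b, homogeneous (Y b) X b) ->
    X :|: Y true :|: Y false = setT ->
  colorful_biclique V1 V2 m.
Proof.
elim: n X Y => [|n IHn] X Y Xn smallY homY XY.
  have /andP[Yt1 _] := smallY true; have /andP[Yf1 _] := smallY false.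
  have := subset_leq_card (subsetIl X V1); have := card_cover3 V1 XY; lia.
have /andP[Yt1 Yt2] := smallY true; have /andP[Yf1 Yf2] := smallY false.
have big1 : 2 * m < #|X :&: V1| by have := card_cover3 V1 XY; lia.
have big2 : 2 * m < #|X :&: V2| by have := card_cover3 V2 XY; lia.
have cardX Z W V : X = Z :|: W -> #|X :&: V| <= #|Z :&: V| + #|W :&: V|.
  by move->; rewrite setIUl; case: (leq_card_setU (Z :&: V) (W :&: V)).
(* A small part [Z] joins [Y b]. If the result has [m] vertices of one colour, [W] still has more
   than [m] of the other; if not, the descent continues in [W]. *)
have step (Z W : {set G}) b : Z != set0 -> X = Z :|: W -> [disjoint Z & W] ->
    homogeneous Z W b -> small Z -> colorful_biclique V1 V2 m.
  move=> Zn0 XE ZW homZW /andP[Z1 Z2].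
  have W1 := cardX Z W V1 XE; have W2 := cardX Z W V2 XE.
  have WX : W \subset X by rewrite XE subsetUr.
  have homYZ : homogeneous (Y b :|: Z) W b.
    by move=> x y /setUP[xY|xZ] yW; [rewrite (homY b) ?(subsetP WX)|apply: homZW].
  have [big|small1] := leqP m #|(Y b :|: Z) :&: V1|.
    apply: (homogeneous_biclique (subsetIr _ _) (subsetIr _ _) big _
              (B := W :&: V2) (b := b)); first lia.
    by move=> x y /setIP[xY _] /setIP[yW _]; apply: homYZ.
  have [big|small2] := leqP m #|(Y b :|: Z) :&: V2|.
    apply: (homogeneous_biclique (subsetIr _ _) (subsetIr _ _) _ big
              (A := W :&: V1) (b := b)); first lia.
    by move=> x y /setIP[xW _] /setIP[yY _]; apply: (homogeneous_sym homYZ).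
  apply: (IHn W (fun c => if c == b then Y b :|: Z else Y c)).
  - move: Xn Zn0; rewrite XE cardsU (disjoint_setI0 ZW) cards0 -card_gt0; lia.
  - by move=> c; case: eqP => _; rewrite ?smallY // /small small1 small2.
  - by move=> c; case: eqP => [->//|_] x y xY yW; rewrite (homY c) ?(subsetP WX).
  - rewrite -XY XE; apply/setP => x; rewrite !inE.
    by case: {homZW homYZ small1 small2} b; rewrite /= !inE;
      case: (x \in W); case: (x \in Z); case: (x \in Y true); case: (x \in Y false).
have [X3 [X4 [b [X3n0 X4n0 XE X34 hom]]]] : splits X.
  apply: splitsG; have := subset_leq_card (subsetIl X V1); lia.
have X1 := cardX X3 X4 V1 XE; have X2 := cardX X3 X4 V2 XE.
(* One part, say [X3], has [m] vertices of [V1]. Without a bi-clique [X4] has fewer than [m] of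
   [V2], so [X3] has [m] of [V2] and [X4] fewer than [m] of [V1]: [X4] is small. *)
have [X31|X31] := leqP m #|X3 :&: V1|; have [X42|X42] := leqP m #|X4 :&: V2|.
- apply: (homogeneous_biclique (subsetIr _ _) (subsetIr _ _) X31 X42 (b := b)).
  by move=> x y /setIP[xX _] /setIP[yX _]; apply: hom.
all: have [X41|X41] := leqP m #|X4 :&: V1|; have [X32|X32] := leqP m #|X3 :&: V2|.
all: try by apply: (homogeneous_biclique (subsetIr _ _) (subsetIr _ _) X41 X32 (b := b));
  move=> x y /setIP[xX _] /setIP[yX _]; apply: (homogeneous_sym hom).
all: try lia.
all: try by apply: (step X3 X4 b) => //; rewrite /small X31 X32.
all: apply: (step X4 X3 b); rewrite // 1?setUC 1?disjoint_sym //;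
  [exact: homogeneous_sym | by rewrite /small X41 X42].
Qed.

End CographDescent.

Lemma cograph_biclique (G : sgraph) (V1 V2 : {set G}) m :
    cograph G -> 4 * m <= #|V1| -> 4 * m <= #|V2| -> colorful_biclique V1 V2 m.
Proof.
move=> /cograph_splits splitsG mV1 mV2; have [->|m_gt0] := posnP m.
  exact: colorful0.
apply: (@cograph_descent _ _ _ _ splitsG mV1 mV2 #|G| setT (fun=> set0)).
- exact: max_card.
- by move=> b; rewrite !set0I cards0 m_gt0.
- by move=> b x y; rewrite inE.
- by rewrite !setU0.
Qed.

(** * Few non-homogeneous blocks *)

Lemma double_count (U I : finType) (D : {set U}) (J : {set I})
    (F : U -> I -> bool) :
  \sum_(i in J) #|[set u in D | F u i]| = \sum_(u in D) #|[set i in J | F u i]|.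
Proof.
transitivity (\sum_(i in J) \sum_(u in D) F u i).
  apply: eq_bigr => i _; rewrite cardsE -sum1_card big_mkcondr /=.
  by apply: eq_bigr => u _; case: (F u i).
rewrite exchange_big; apply: eq_bigr => u _.
rewrite cardsE -sum1_card big_mkcondr /=.
by apply: eq_bigr => i _; case: (F u i).
Qed.

(* Greedy choice: by averaging, some unused [i] is related to at least a
   quarter of the surviving elements of [D]. *)
Lemma greedy_biclique (U I : finType) (D : {set U}) (F : U -> I -> bool) h a :
    0 < #|D| -> (forall u, u \in D -> h <= #|[set i | F u i]|) ->
    a <= h -> #|I| + 3 * a <= 4 * h + 3 ->
  exists (A : {set I}) (D' : {set U}),
    [/\ #|A| = a, D' \subset D, #|D| <= #|D'| * 4 ^ a &
        {in D' & A, forall u i, F u i}].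
Proof.
move=> D0 Dh; elim: a => [|a IHa] ah Ih.
  exists set0, D; split; rewrite ?cards0 ?muln1 //.
  by move=> u i _; rewrite inE.
have [||A [D' [cA D'D DD' AF]]] := IHa; [lia|lia|].
have D'0 : 0 < #|D'| by move: DD'; rewrite -(ltn_pmul2r (expn_gt0 4 a)); lia.
have [[i iA iD]|noi] :=
    pselect (exists2 i, i \notin A & #|D'| <= 4 * #|[set u in D' | F u i]|).
  exists (i |: A), [set u in D' | F u i]; split.
  - by rewrite cardsU1 iA cA.
  - by apply/subsetP => u; rewrite inE => /andP[/(subsetP D'D)].
  - by rewrite expnS; apply: leq_trans DD' _; rewrite mulnA leq_mul2r mulnC iD orbT.
  - by move=> u j; rewrite !inE => /andP[uD uF] /orP[/eqP->//|]; apply: AF.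
have lo : #|D'| * (h - a) <= \sum_(i in ~: A) #|[set u in D' | F u i]|.
  rewrite double_count -sum_nat_const; apply: leq_sum => u uD.
  have := cardsID A [set i | F u i]; have := Dh u (subsetP D'D u uD).
  have := subset_leq_card (subsetIr [set i | F u i] A).
  rewrite (_ : _ :\: A = [set i in ~: A | F u i]); last first.
    by apply/setP => i; rewrite !inE.
  lia.
have up : \sum_(i in ~: A) 4 * #|[set u in D' | F u i]| <= #|~: A| * #|D'|.-1.
  rewrite -sum_nat_const; apply: leq_sum => i; rewrite inE => iA.
  rewrite -ltnS prednK // ltnNge; apply/negP => iD; apply: noi; by exists i.
rewrite -big_distrr /= in up.
have cAC := cardsC A; rewrite cA in cAC.
have : 4 * (#|D'| * (h - a)) <= (#|I| - a) * #|D'|.-1.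
  by rewrite -cAC addKn; apply: leq_trans up; rewrite leq_pmul2l.
(* The numerical hypothesis at [a.+1] amounts to [#|I| - a <= 4 * (h - a)]. *)
have le4 : (#|I| - a) * #|D'|.-1 <= 4 * (h - a) * #|D'|.-1.
  by rewrite leq_mul2r; apply/orP; right; lia.
move=> /leq_trans/(_ le4); rewrite (mulnC #|D'|) mulnA leq_pmul2l ?muln_gt0; lia.
Qed.

Lemma card_disjoint_bigcup (T I : finType) (B : I -> {set T}) (A : {set I}) t :
    (forall i j, i != j -> [disjoint B i & B j]) -> (forall i, #|B i| = t) ->
  #|\bigcup_(i in A) B i| = #|A| * t.
Proof.
move=> Bdisj Bt; rewrite big_mkcond -sum1_card partition_disjoint_bigcup /=.
  rewrite -sum_nat_const [RHS]big_mkcond /=; apply: eq_bigr => i _.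
  by case: ifP => _; rewrite sum1_card ?Bt ?cards0.
by move=> i j ij; do 2?case: ifP => _; rewrite ?Bdisj // -setI_eq0 ?set0I ?setI0.
Qed.

(** Each [u] in [D] is complete or anticomplete to at least [s - q] blocks, so to [(s - q)./2] of
    one type. The factor 2 in the bound on [D] pays for fixing the type; the greedy choice then
    finds [a] blocks. *)
Lemma blocks_biclique (G : sgraph) (V1 V2 D : {set G}) (s t a q m : nat)
    (B : 'I_s -> {set G}) :
    D \subset V1 -> (forall i, B i \subset V2) -> (forall i, #|B i| = t) ->
    (forall i j, i != j -> [disjoint B i & B j]) ->
    (forall u, u \in D ->
      #|[set i | [exists y in B i, edge u y] && [exists y in B i, ~~ edge u y]]|
        <= q) ->
    a <= (s - q)./2 -> s + 3 * a <= 4 * (s - q)./2 + 3 -> m <= a * t ->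
    2 * (m * 4 ^ a) <= #|D| ->
  colorful_biclique V1 V2 m.
Proof.
move=> DV BV Bt Bdisj Dq ah sa mat mD; have [->|m_gt0] := posnP m.
  exact: colorful0.
set h := (s - q)./2 in ah sa.
pose F b u i := [forall y in B i, edge u y == b].
have Fh u : u \in D -> 2 * h <= #|[set i | F true u i]| + #|[set i | F false u i]|.
  move=> /Dq; set P := [set i | _ && _] => Pq.
  have cov : [set i | F true u i] :|: [set i | F false u i] :|: P = setT.
    apply/setP => i; rewrite !inE -orbA.
    case: (boolP (F true u i)) => //=; rewrite negb_forall_in.
    case/exists_inP=> y yB; rewrite eqb_id => yF.
    case: (boolP (F false u i)) => //=; rewrite negb_forall_in.
    case/exists_inP=> z zB; rewrite eqbF_neg negbK => zF.
    by apply/andP; split; apply/exists_inP; [exists z|exists y].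
  have := card_cover3 setT cov; rewrite !setIT cardsT card_ord.
  rewrite /h; lia.
have half b (D' : {set G}) : D' \subset D -> m * 4 ^ a <= #|D'| ->
    (forall u, u \in D' -> h <= #|[set i | F b u i]|) -> colorful_biclique V1 V2 m.
  move=> D'D mD' D'h.
  have D'0 : 0 < #|D'| by apply: leq_trans mD'; rewrite muln_gt0 m_gt0 expn_gt0.
  rewrite -[s in s + _]card_ord in sa.
  have [A [E [cA ED' D'E EA]]] := greedy_biclique D'0 D'h ah sa.
  apply: (@homogeneous_biclique _ V1 V2 E (\bigcup_(i in A) B i) b).
  - exact: subset_trans ED' (subset_trans D'D DV).
  - by apply/bigcupsP.
  - by move: (leq_trans mD' D'E); rewrite leq_pmul2r ?expn_gt0.
  - by rewrite (card_disjoint_bigcup A Bdisj Bt) cA.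
  - move=> x y xE /bigcupP[i iA yB]; apply/eqP.
    by move: (EA x i xE iA) => /forall_inP; apply.
pose D1 := [set u in D | h <= #|[set i | F true u i]|].
have D1D : D1 \subset D by apply/subsetP => u; rewrite inE => /andP[].
have := cardsID D1 D; rewrite (setIidPr D1D).
have [big|small] := leqP (m * 4 ^ a) #|D1|.
  by move=> _; apply: (half true D1) => // u; rewrite inE => /andP[].
move=> DD1; apply: (half false (D :\: D1)); [exact: subsetDl|lia|].
move=> u /setDP[uD]; rewrite inE uD andTb -ltnNge => ltF.
by have := Fh u uD; lia.
Qed.

(** Pigeonhole: while more than [#|K| * t.-1] elements remain, some fibre of [c] has [t] of them,
    and its [t] lowest form the next block. Later blocks from the same fibre thus lie above it. *)
Lemma monotone_blocks (T I : finType) (c : T -> I) (d : T -> nat) (K : {set I})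
    t s (Y : {set T}) :
    0 < t -> {in Y, forall y, c y \in K} -> s * t + #|K| * t.-1 <= #|Y| ->
  exists B : nat -> {set T},
    [/\ forall i, i < s -> B i \subset Y, forall i, i < s -> #|B i| = t,
        forall i, i < s -> {in B i &, forall y z, c y = c z},
        forall i j, i < j < s -> [disjoint B i & B j] &
        forall i j, i < j < s ->
          {in B i & B j, forall y z, c y = c z -> d y <= d z}].
Proof.
move=> t_gt0; elim: s Y => [|s IHs] Y YK sY.
  by exists (fun=> set0); split=> // i j; rewrite ltn0 andbF.
have [i iK it] : exists2 i, i \in K & t <= #|[set y in Y | c y == i]|.
  apply/exists_inP; apply: contraLR sY; rewrite negb_exists_in => /forall_inP K_t.
  rewrite -ltnNge -sum1_card (partition_big c (mem K)) //=.
  apply: (@leq_ltn_trans (\sum_(i in K) t.-1)).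
    apply: leq_sum => i iK; have := K_t i iK; rewrite -ltnNge cardsE -sum1_card.
    by rewrite -{1}(prednK t_gt0) ltnS.
  by rewrite sum_nat_const; nia.
have [B0 [B0Y cB0 ordB0]] := @initial_segment _ (fun x y => d x <= d y) _ t
  (fun x y => leq_total _ _) (fun y x z => @leq_trans _ _ _) it.
have B0Y' : B0 \subset Y.
  by apply: subset_trans B0Y _; apply/subsetP => y; rewrite inE => /andP[].
have [||B [BY cB Bc Bdisj Bord]] := IHs (Y :\: B0).
- by move=> y /setDP[/YK].
- by rewrite cardsDS // cB0; lia.
exists (fun j => if j is j'.+1 then B j' else B0); split.
- by case=> [//|j] /BY /subset_trans; apply; apply: subsetDl.
- by case=> [//|j] /cB.
- case=> [_|j /Bc//] y z /(subsetP B0Y) + /(subsetP B0Y); rewrite !inE.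
  by move=> /andP[_ /eqP->] /andP[_ /eqP->].
- case=> [|j] [|j'] // js; last exact: Bdisj.
  by rewrite disjoint_sym; have := BY j' js; rewrite subsetD => /andP[].
- case=> [|j] [|j'] // js; last exact: Bord.
  move=> y z yB zB cyz; apply: ordB0 => //.
  have := subsetP B0Y y yB; rewrite inE cyz => /andP[_ cz].
  by have := subsetP (BY j' js) z zB; rewrite !inE cz => /andP[-> ->].
Qed.

(** On each chain the neighbours of [u] in [V2] form an initial segment, so only the block in which
    this segment ends can be mixed. A block of size 1 is never mixed. *)
Lemma prefix_biclique (G : sgraph) (V1 V2 D : {set G}) (I : finType)
    (c : G -> I) (d : G -> nat) (K : {set I}) s t a q m :
    D \subset V1 -> {in V2, forall y, c y \in K} ->
    (forall u, u \in D -> {in V2 &, forall y z,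
       c y = c z -> d y <= d z -> edge u z -> edge u y}) ->
    0 < t -> s * t + #|K| * t.-1 <= #|V2| -> (t == 1) || (#|K| <= q) ->
    a <= (s - q)./2 -> s + 3 * a <= 4 * (s - q)./2 + 3 -> m <= a * t ->
    2 * (m * 4 ^ a) <= #|D| ->
  colorful_biclique V1 V2 m.
Proof.
move=> DV cK prefix t_gt0 sV2 tq aq sa mat mD.
have [B [BV Bt Bc Bdisj Bord]] := monotone_blocks d t_gt0 cK sV2.
have blk (i : 'I_s) : exists y, y \in B i.
  by apply/card_gt0P; rewrite Bt.
have [f fB] := choice blk.
apply: (@blocks_biclique G V1 V2 D s t a q m (fun i => B i)) => //.
- by move=> i; apply: BV.
- by move=> i; apply: Bt.
- move=> i j; rewrite neq_ltn => /orP[] ij; last rewrite disjoint_sym.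
    by apply: Bdisj; rewrite ij /=.
  by apply: Bdisj; rewrite ij /=.
move=> u uD; set P := [set i | _].
(* In two mixed blocks on one chain, a non-neighbour in the lower block would precede a neighbour in
   the upper one. *)
have sep (i j : 'I_s) : i < j -> i \in P -> j \in P -> c (f i) != c (f j).
  move=> ij; rewrite !inE => /andP[_ /exists_inP[y yB /negP yu]].
  move=> /andP[/exists_inP[z zB zu] _]; apply/eqP => cij.
  have cyz : c y = c z.
    by rewrite (Bc i _ _ (f i)) // cij (Bc j _ _ z).
  apply: yu; apply: (prefix u uD y z) => //.
  - exact: (subsetP (BV i _)).
  - exact: (subsetP (BV j _)).
  - by apply: (Bord i j) => //; rewrite ij /=.
have [/eqP t1|] := boolP (t == 1).
  rewrite (_ : P = set0) ?cards0 //; apply/setP => i; rewrite !inE.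
  apply/negP => /andP[/exists_inP[y yB yu] /exists_inP[z zB]].
  have /eqP/cards1P[x Bx] : #|B i| = 1 by rewrite Bt.
  by move: yB zB; rewrite Bx !inE => /eqP<- /eqP->; rewrite yu.
move=> /negPf t1; rewrite t1 /= in tq; apply: leq_trans tq.
rewrite -(card_in_imset (f := fun i => c (f i))); last first.
  move=> i j iP jP cij; case: (ltngtP i j) => [ij|ij|/val_inj //].
    by have := sep i j ij iP jP; rewrite cij eqxx.
  by have := sep j i ij jP iP; rewrite cij eqxx.
apply: subset_leq_card; apply/subsetP => _ /imsetP[i _ ->].
by apply: cK; apply: (subsetP (BV i _)).
Qed.

(** * Trees *)

Section Trees.
Variable T : sgraph.
Implicit Types (x y z w : T) (p q : seq T) (S : {set T}).

(** The relation inside [is_subtree]; with [S = [set~ x]] it also describes the components of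
    [T - x]. *)
Definition edge_in S := [rel u v : T | [&& u \in S, v \in S & edge u v]].

Lemma edge_in_sub S1 S2 x y :
  S1 \subset S2 -> connect (edge_in S1) x y -> connect (edge_in S2) x y.
Proof.
move=> S12; apply: connect_sub => u v /and3P[uS vS uv].
by apply: connect1; rewrite /= !(subsetP S12) ?uv.
Qed.

Lemma edge_in_sym S : symmetric (edge_in S).
Proof. by move=> u v /=; rewrite edge_sym andbCA. Qed.

Lemma connect_in_sym S : connect_sym (edge_in S).
Proof. exact/sym_connect_sym/edge_in_sym. Qed.

Lemma path_in_connect S x p :
  path edge x p -> x \in S -> {subset p <= S} -> connect (edge_in S) x (last x p).
Proof.
elim: p x => //= y p IHp x /andP[xy yp] xS pS.
have yS : y \in S by apply: pS; rewrite inE eqxx.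
apply: (@connect_trans _ _ y); first by apply: connect1; rewrite /= xS yS.
by apply: IHp => // z zp; apply: pS; rewrite inE zp orbT.
Qed.

Lemma connect_in_path S x y :
  connect (edge_in S) x y ->
  exists p, [/\ path edge x p, uniq (x :: p), last x p = y & {subset p <= S}].
Proof.
case/connectP => p xp ->; case: (shortenP xp) => q xq uq _; exists q; split=> //.
  by apply: sub_path xq => u v /and3P[].
move: xq {uq}; elim: q x {xp} => //= z q IHq x /andP[/and3P[_ zS _] zq] w.
by rewrite inE => /orP[/eqP->//|]; apply: IHq zq w.
Qed.

Lemma connect_uniq_path x y :
  connect edge x y ->
  exists p, [/\ path edge x p, uniq (x :: p) & last x p = y].
Proof.
case/connectP => p xp ->.
by case: (shortenP xp) => q xq uq _; exists q.
Qed.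

Hypothesis acyclicT : sg_acyclic T.

(** If the first steps differ, the remainders of the two paths join [a] to [b] without passing [x],
    which closes a cycle through [x]. *)
Lemma uniq_path_unique x p q :
    path edge x p -> path edge x q -> uniq (x :: p) -> uniq (x :: q) ->
  last x p = last x q -> p = q.
Proof.
elim: p x q => [|a p IHp] x [|b q] //=.
- by move=> _ _ _ /andP[xq _] xE; rewrite xE mem_last in xq.
- by move=> _ _ /andP[xp _] _ xE; rewrite -xE mem_last in xp.
move=> /andP[xa ap] /andP[xb bq] /andP[xap uap] /andP[xbq ubq] ab.
have [eab|neab] := eqVneq a b.
  by subst b; congr cons; apply: (IHp a).
have : connect (edge_in [set~ x]) a b.
  apply: (@connect_trans _ _ (last a p)).
    apply: path_in_connect => //; rewrite ?inE.
      by apply: contraNneq xap => ->; rewrite mem_head.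
    by move=> z zp; rewrite !inE; apply: contraNneq xap => <-; rewrite inE zp orbT.
  rewrite connect_in_sym ab; apply: path_in_connect => //; rewrite ?inE.
    by apply: contraNneq xbq => ->; rewrite mem_head.
  by move=> z zq; rewrite !inE; apply: contraNneq xbq => <-; rewrite inE zq orbT.
case/connect_in_path => r [ar uar rb rx].
have [] := @acyclicT (x :: a :: r).
  by case: r {ar uar rx} rb => [ab'|//]; rewrite /= in ab'; rewrite ab' eqxx in neab.
apply/andP; split.
  by rewrite /= rcons_path xa ar rb /= edge_sym.
rewrite [uniq _]/= -/(uniq (a :: r)) uar andbT inE negb_or.
rewrite (contraNneq _ xap) => [|->]; last by rewrite mem_head.
by apply/negP => /rx; rewrite !inE eqxx.
Qed.

Hypothesis connT : forall x y, connect (edge : rel T) x y.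

(** The simple path from [x] to [z], listed without [x], so that its size is the distance. *)
Definition tree_path x z := projT1 (cid (connect_uniq_path (connT x z))).

Lemma tree_pathP x z :
  [/\ path edge x (tree_path x z), uniq (x :: tree_path x z) &
      last x (tree_path x z) = z].
Proof. by rewrite /tree_path; case: cid. Qed.

Lemma tree_pathE x p :
  path edge x p -> uniq (x :: p) -> tree_path x (last x p) = p.
Proof.
move=> xp uxp; have [xq uxq lq] := tree_pathP x (last x p).
exact: uniq_path_unique xq xp uxq uxp lq.
Qed.

(** Subtrees are convex, since a simple path inside [S] is, by uniqueness, the tree path. *)
Lemma tree_path_in S x z :
  is_subtree S -> x \in S -> z \in S -> {subset x :: tree_path x z <= S}.
Proof.
case=> _ conS xS zS w; rewrite inE => /orP[/eqP->//|].
have [p [xp uxp <- pS]] := connect_in_path (conS x z xS zS).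
by rewrite tree_pathE //; apply: pS.
Qed.

Lemma tree_path_prefix x y z :
  y \in x :: tree_path x z -> exists s, tree_path x z = tree_path x y ++ s.
Proof.
have [xp uxp lp] := tree_pathP x z.
rewrite inE => /orP[/eqP->|yp].
  by exists (tree_path x z); rewrite (_ : tree_path x x = [::]) ?(@tree_pathE x [::]).
move: xp uxp lp; case: (splitPr yp) => p1 p2 + + _.
rewrite -cat_rcons cat_path -cat_cons cat_uniq => /andP[xp _] /andP[uxp _].
by exists p2; rewrite -{2}(last_rcons x p1 y) tree_pathE.
Qed.

(** With [x] as root, one end of an edge is the parent of the other: if each lay on the path to the
    other, the two paths would be equal. *)
Lemma tree_path_adj x w z : edge w z ->
  tree_path x z = rcons (tree_path x w) z \/
  tree_path x w = rcons (tree_path x z) w.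
Proof.
have ext u v : edge u v -> v \notin x :: tree_path x u ->
    tree_path x v = rcons (tree_path x u) v.
  move=> uv vu; have [xp uxp lp] := tree_pathP x u.
  rewrite -[in LHS](last_rcons x (tree_path x u) v) tree_pathE //.
    by rewrite rcons_path xp lp.
  by rewrite -rcons_cons rcons_uniq vu.
move=> wz; have [zw|zw] := boolP (z \in x :: tree_path x w); last first.
  by left; apply: ext.
have [wz'|wz'] := boolP (w \in x :: tree_path x z); last first.
  by right; apply: ext; rewrite // edge_sym.
have [s sE] := tree_path_prefix zw; have [s' s'E] := tree_path_prefix wz'.
move: (s'E); rewrite sE -catA -{1}[tree_path x z]cats0 => /eqP.
rewrite eqseq_cat // => /andP[_ /eqP]; case: s sE => // sE _.
have [_ _ lw] := tree_pathP x w; have [_ _ lz] := tree_pathP x z.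
by move: wz; rewrite -lw -lz sE cats0 edge_irr.
Qed.

(* [y] is the vertex of [S] nearest to [x]. *)
Lemma subtree_top x S : is_subtree S ->
  exists y, y \in S /\ forall R : {set T}, is_subtree R -> x \in R ->
    R :&: S != set0 -> y \in R.
Proof.
move=> treeS; have [xS|xS] := boolP (x \in S); first by exists x.
have /set0Pn[s0 s0S] : S != set0 by case: treeS.
have [xp uxp lp] := tree_pathP x s0.
have hasS : has (mem S) (tree_path x s0).
  apply/hasP; exists s0 => //; have := mem_last x (tree_path x s0).
  by rewrite lp inE => /orP[/eqP sx|//]; rewrite -sx s0S in xS.
move: xp uxp {lp}; case: (split_find hasS) => y q1 q2 yS q1S.
rewrite cat_path -cat_cons cat_uniq => /andP[xq1 _] /andP[uxq1 _].
(* [y] is the first vertex of [S] on the path to [s0]. The path from [x] to [y], continued inside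
   [S] to [z], is simple, so it is the tree path to [z] and stays in [R]. *)
exists y; split=> // R treeR xR /set0Pn[z /setIP[zR zS]].
have [q [yq uyq lq qS]] := connect_in_path (treeS.2 y z yS zS).
have zE : last x (rcons q1 y ++ q) = z by rewrite last_cat last_rcons.
apply: (tree_path_in treeR xR zR); rewrite -zE tree_pathE.
- by rewrite inE mem_cat mem_rcons mem_head orbT.
- by rewrite cat_path xq1 last_rcons.
rewrite -cat_cons cat_uniq uxq1; move: uyq; rewrite /= => /andP[yq' ->].
rewrite andbT; apply/hasPn => w wq; rewrite inE negb_or.
apply/andP; split; first by apply: contraNneq xS => <-; apply: qS.
rewrite mem_rcons inE negb_or; apply/andP; split.
  by apply: contraNneq yq' => <-.
by apply: contra q1S => wq1; apply/hasP; exists w => //; apply: qS.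
Qed.

(* The chains are the paths from [x] to the leaves; [c y] is the end of the
   chain of [y]. *)
Lemma tree_chains x :
  exists (c : T -> T) (K : {set T}), [/\ forall y, c y \in K,
    #|K| <= maxn 1 #|leaves T| &
    forall R : {set T}, is_subtree R -> x \in R -> forall y z, c y = c z ->
      size (tree_path x y) <= size (tree_path x z) -> z \in R -> y \in R].
Proof.
(* [c y] will be a vertex farthest from [x] among those whose path from [x] passes [y]. *)
have far y : exists z, y \in x :: tree_path x z /\
    forall z', y \in x :: tree_path x z' -> size (tree_path x z') <= size (tree_path x z).
  have yy : y \in x :: tree_path x y.
    by have [_ _ {1}<-] := tree_pathP x y; apply: mem_last.
  case: (@arg_maxnP _ y (fun z => y \in x :: tree_path x z)
    (fun z => size (tree_path x z)) yy) => z yz zmax.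
  by exists z; split.
have [c cP] := choice far.
exists c, (c @: setT); split.
- by move=> y; apply: imset_f.
(* A neighbour of [c y] other than its parent would be farther away, so [c y] is a leaf unless the
   tree is a single vertex. *)
- have nbr y w : edge w (c y) -> tree_path x (c y) = rcons (tree_path x w) (c y).
    move=> wc; have [//|E] := tree_path_adj x wc.
    have [yc cmax] := cP y; have := cmax w.
    rewrite E -rcons_cons mem_rcons inE yc orbT size_rcons => /(_ isT).
    by rewrite ltnn.
  have [T1|T1] := leqP #|T| 1.
    by rewrite leq_max (leq_trans (max_card _) T1).
  rewrite leq_max; apply/orP; right; apply: subset_leq_card.
  apply/subsetP => _ /imsetP[y _ ->]; rewrite inE eqn_leq; apply/andP; split.
    apply/card_le1_eqP => w w'; rewrite !inE => wc wc'.
    have := nbr y w; rewrite edge_sym => /(_ wc) E.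
    have := nbr y w'; rewrite edge_sym => /(_ wc'); rewrite E.
    move/eqP; rewrite eqseq_rcons => /andP[/eqP E' _].
    by have [_ _ <-] := tree_pathP x w'; have [_ _ <-] := tree_pathP x w; rewrite E'.
  apply/card_gt0P; have [z zc] : exists z, z != c y.
    case/card_gt1P: T1 => z [z' [_ _ zz']].
    by have [zE|] := eqVneq z (c y); [exists z'; rewrite -zE eq_sym|exists z].
  have := tree_pathP (c y) z; case: (tree_path _ _) => [|w p] /= [cw _ lw].
    by rewrite -lw eqxx in zc.
  by exists w; rewrite inE; case/andP: cw.
(* [y] and [z] both lie on the path to the common end, so the nearer one lies on the path to the
   other. *)
move=> R treeR xR y z cyz yz zR; apply: (tree_path_in treeR xR zR).
have [yc _] := cP y; have [zc _] := cP z; rewrite -cyz in zc.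
have [s sE] := tree_path_prefix yc; have [s' s'E] := tree_path_prefix zc.
have [_ _ {1}<-] := tree_pathP x y.
have -> : tree_path x y = take (size (tree_path x y)) (tree_path x z).
  by rewrite -(takel_cat s') // -s'E sE take_size_cat.
have := mem_last x (take (size (tree_path x y)) (tree_path x z)).
by rewrite !inE => /orP[->//|/mem_take ->]; rewrite orbT.
Qed.

End Trees.

(** * A vertex in almost all subtrees of one colour *)

(** A class with [m] elements of [A] either has [m] elements of [B] too or leaves [m] of them
    outside; likewise with [A] and [B] exchanged. If all classes are small, they can be grouped. *)
Lemma dominant_class (G : sgraph) (V1 V2 A B : {set G}) (I : finType)
    (f : G -> I) m :
    A \subset V1 -> B \subset V2 -> 0 < m -> 4 * m <= #|A| -> 4 * m <= #|B| ->
    {in A & B, forall u v, f u != f v -> ~~ edge u v} ->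
  colorful_biclique V1 V2 m \/
  exists i, m <= #|[set u in A | f u == i]| /\ m <= #|[set v in B | f v == i]|.
Proof.
move=> AV BV m_gt0 mA mB AB.
have cardI (D : {set G}) (J : {set I}) :
    #|D| = #|[set u in D | f u \in J]| + #|[set u in D | f u \notin J]|.
  rewrite -(cardsID [set u | f u \in J]); congr (_ + _); apply: eq_card => u.
    by rewrite !inE.
  by rewrite !inE andbC.
have anti (J J' : {set I}) : [disjoint J & J'] ->
    m <= #|[set u in A | f u \in J]| -> m <= #|[set v in B | f v \in J']| ->
    colorful_biclique V1 V2 m.
  move=> JJ' mAJ mBJ; apply: (colorful_of_large _ _ mAJ mBJ).
  - by apply: subset_trans AV; apply/subsetP => u; rewrite inE => /andP[].
  - by apply: subset_trans BV; apply/subsetP => u; rewrite inE => /andP[].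
  right=> u v; rewrite !inE => /andP[uA uJ] /andP[vB vJ]; apply: AB => //.
  by apply: contraTneq vJ => <-; rewrite (disjointFr JJ').
have one (D : {set G}) i : [set u in D | f u == i] = [set u in D | f u \in [set i]].
  by apply/setP => u; rewrite !inE.
have notin (D : {set G}) (J : {set I}) :
    [set u in D | f u \notin J] = [set u in D | f u \in ~: J].
  by apply/setP => u; rewrite !inE.
have dJ (J : {set I}) : [disjoint J & ~: J] by rewrite -setI_eq0 setICr.
have dJ' (J : {set I}) : [disjoint ~: J & J] by rewrite disjoint_sym.
have [/existsP[i iA]|/existsPn smallA] :=
    boolP [exists i, m <= #|[set u in A | f u == i]|].
  have [out|ins] := leqP m #|[set v in B | f v \notin [set i]]|.
    by left; apply: (anti [set i] (~: [set i])) => //; rewrite -?one -?notin.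
  by right; exists i; split=> //; rewrite one; have := cardI B [set i]; lia.
have [/existsP[i iB]|/existsPn smallB] :=
    boolP [exists i, m <= #|[set v in B | f v == i]|].
  have [out|ins] := leqP m #|[set u in A | f u \notin [set i]]|.
    by left; apply: (anti (~: [set i]) [set i]) => //; rewrite -?one -?notin.
  by right; exists i; split=> //; rewrite one; have := cardI A [set i]; lia.
(* A minimal union [J] of classes with [m] elements of [A] has fewer than [2m], so more than [2m]
   lie outside; and [B] has [m] elements inside [J] or outside it. *)
left; pose big (J : {set I}) := m <= #|[set u in A | f u \in J]|.
have bigT : big setT.
  rewrite /big (_ : [set u in A | _] = A); first by lia.
  by apply/setP => u; rewrite !inE andbT.
case: (@arg_minnP _ setT big (fun J => #|J|) bigT) => J bigJ minJ.
have /set0Pn[j jJ] : J != set0.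
  apply: contraTneq bigJ => ->; rewrite /big -ltnNge (_ : [set _ in _ | _] = set0).
    by rewrite cards0.
  by apply/setP => u; rewrite !inE andbF.
have AJ : #|[set u in A | f u \in J]| < 2 * m.
  have : ~~ big (J :\ j).
    by apply: contraTN isT => /minJ; rewrite (cardsD1 j J) jJ ltnn.
  rewrite /big -ltnNge; have := smallA j; rewrite -ltnNge.
  rewrite (_ : [set u in A | f u \in J] =
     [set u in A | f u == j] :|: [set u in A | f u \in J :\ j]).
    have [+ _] := leq_card_setU [set u in A | f u == j]
      [set u in A | f u \in J :\ j]; lia.
  apply/setP => u; rewrite !inE -andb_orr; congr (_ && _).
  by have [->|] := eqVneq (f u) j.
have [BJ|BJ] := leqP m #|[set v in B | f v \in J]|.
  by apply: (anti (~: J) J) => //; rewrite -notin; have := cardI A J; lia.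
by apply: (anti J (~: J)) => //; rewrite -notin; have := cardI B J; lia.
Qed.

(* Otherwise every vertex [x] has a component of [T - x] containing at least
   [m] of the subtrees of each colour. A smallest such component, [C], at [x],
   with [x'] the neighbour of [x] in [C]: the component chosen at [x'] must
   contain [x], so it is disjoint from [C]. *)
Lemma popular_vertex (G T : sgraph) (V1 V2 : {set G}) (S : G -> {set T}) m :
    is_tree T -> (forall u, is_subtree (S u)) ->
    {in V1 & V2, forall u v, edge u v = (S u :&: S v != set0)} -> 0 < m ->
  [\/ colorful_biclique V1 V2 m,
      exists x, #|V1| < #|[set u in V1 | x \in S u]| + 4 * m |
      exists x, #|V2| < #|[set v in V2 | x \in S v]| + 4 * m].
Proof.
move=> [[T_gt0 connT] acyclicT] treeS edgeE m_gt0.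
have [pop1|nopop1] := pselect (exists x, #|V1| < #|[set u in V1 | x \in S u]| + 4 * m).
  by apply: Or32.
have [pop2|nopop2] := pselect (exists x, #|V2| < #|[set u in V2 | x \in S u]| + 4 * m).
  by apply: Or33.
apply: Or31; apply: contrapT => nocol.
have cardN (V : {set G}) x : ~ (exists x, #|V| < #|[set u in V | x \in S u]| + 4 * m) ->
    4 * m <= #|[set u in V | x \notin S u]|.
  move=> nopop; rewrite leqNgt; apply/negP => lt4; apply: nopop; exists x.
  rewrite -(cardsID [set u | x \in S u] V).
  rewrite (_ : V :&: _ = [set u in V | x \in S u]); last by apply/setP => u; rewrite !inE.
  rewrite (_ : V :\: _ = [set u in V | x \notin S u]); first by rewrite ltn_add2l.
  by apply/setP => u; rewrite !inE andbC.
have point u : exists z, z \in S u by apply/set0Pn; case: (treeS u).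
have [rep repS] := choice point.
pose C (x c : T) := [set z | connect (edge_in [set~ x]) c z].
have avoidC x c z : c != x -> z \in C x c -> z != x.
  move=> cx; rewrite inE => /connect_in_path[p [_ _ <- pS]].
  have := mem_last c p; rewrite inE => /orP[/eqP->//|/pS].
  by rewrite !inE.
have inC x u z : x \notin S u -> z \in S u -> connect (edge_in [set~ x]) (rep u) z.
  move=> xu zu; apply: (@edge_in_sub _ (S u)).
    by apply/subsetP => y yu; rewrite !inE; apply: contraNneq xu => <-.
  by case: (treeS u) => _; apply.
pose good (xc : T * T) := [&& xc.2 != xc.1,
  m <= #|[set u in V1 | S u \subset C xc.1 xc.2]| &
  m <= #|[set v in V2 | S v \subset C xc.1 xc.2]|].
(* The classes are the components of [T - x]: a subtree avoiding [x] lies in the component of its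
   vertex [rep u]. *)
have good_ex x : exists c, good (x, c).
  have csym := @connect_in_sym T [set~ x].
  have [||||||//|[i [iA iB]]] := @dominant_class G V1 V2
     [set u in V1 | x \notin S u] [set u in V2 | x \notin S u] T
     (fun u => fingraph.root (edge_in [set~ x]) (rep u)) m.
  - by apply/subsetP => u; rewrite inE => /andP[].
  - by apply/subsetP => u; rewrite inE => /andP[].
  - exact: m_gt0.
  - exact: cardN.
  - exact: cardN.
  - move=> u v; rewrite !inE => /andP[uV xu] /andP[vV xv]; apply: contraNN.
    rewrite edgeE // => /set0Pn[z /setIP[zu zv]].
    rewrite root_connect //; apply: (connect_trans (inC _ _ _ xu zu)).
    by rewrite csym inC.
  have /card_gt0P[u] := leq_trans m_gt0 iA.
  rewrite !inE => /andP[/andP[uV xu] /eqP ui]; exists (rep u).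
  have sub (V : {set G}) : [set v in [set w in V | x \notin S w]
        | fingraph.root (edge_in [set~ x]) (rep v) == i] \subset
      [set v in V | S v \subset C x (rep u)].
    apply/subsetP => v; rewrite !inE -ui => /andP[/andP[-> xv]].
    rewrite root_connect // csym => uv; apply/subsetP => z zv; rewrite inE.
    by apply: (connect_trans uv); apply: inC.
  rewrite /good /= (leq_trans iA (subset_leq_card (sub _))).
  rewrite (leq_trans iB (subset_leq_card (sub _))) !andbT.
  by apply: contraNneq xu => <-.
have [x0 _] : exists x0, x0 \in T by apply/card_gt0P.
have [c0 good0] := good_ex x0.
case: (@arg_minnP _ (x0, c0) good (fun xc => #|C xc.1 xc.2|) good0).
move=> [x c] goodxc minxc.
have /and3P[/= cx m1 m2] := goodxc.
have [p [xp uxp lp]] := connect_uniq_path (connT x c).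
case: p xp uxp lp => [|x' p] /=; first by move=> _ _ xc; rewrite xc eqxx in cx.
move=> /andP[xx' x'p] /andP[xx'p ux'p] lp.
have x'x : x' != x by apply: contraNneq xx'p => ->; rewrite mem_head.
have x'c : connect (edge_in [set~ x]) x' c.
  rewrite -lp; apply: path_in_connect => //; first by rewrite !inE.
  by move=> z zp; rewrite !inE; apply: contraNneq xx'p => <-; rewrite inE zp orbT.
have x'C : x' \in C x c by rewrite inE connect_in_sym.
have [c' goodc'] := good_ex x'; have /and3P[/= cx' m1' m2'] := goodc'.
have [xC|xC] := boolP (x \in C x' c').
  (* A common vertex [z] would be reached from [x] by a simple path through [x'] and by one avoiding
     [x']. *)
  have disj : [disjoint C x c & C x' c'].
    rewrite -setI_eq0; apply/eqP/setP => z; rewrite in_setI in_set0.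
    apply/negP => /andP[zC zC']; rewrite inE in zC; rewrite !inE in xC zC'.
    have := connect_trans x'c zC; case/connect_in_path => q1 [xq1 uxq1 lq1 q1x].
    have : connect (edge_in [set~ x']) x z.
      by apply: connect_trans zC'; rewrite connect_in_sym.
    case/connect_in_path => q2 [xq2 uxq2 lq2 q2x].
    have q2E : x' :: q1 = q2.
      apply: (uniq_path_unique acyclicT (x := x)) => //=.
      - by rewrite xx' xq1.
      - rewrite -/(uniq (x' :: q1)) uxq1 andbT inE negb_or eq_sym x'x /=.
        by apply/negP => /q1x; rewrite !inE eqxx.
      - by rewrite lq1 lq2.
    have : x' \in [set~ x'] by apply: q2x; rewrite -q2E mem_head.
    by rewrite !inE eqxx.
  apply: nocol; apply: (colorful_of_large _ _ m1 m2').
  - by apply/subsetP => u; rewrite inE => /andP[].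
  - by apply/subsetP => u; rewrite inE => /andP[].
  right=> u v; rewrite !inE => /andP[uV uC] /andP[vV vC].
  rewrite edgeE // negbK -subset0 -(disjoint_setI0 disj); exact: setISS.
(* If [x] is not in [C x' c'], that component lies in [C x c] and misses [x'], against
   minimality. *)
have /= := minxc _ goodc'; rewrite leqNgt => /negP; apply; apply: proper_card.
apply/properP; split; last first.
  exists x' => //; apply/negP => /(avoidC _ _ _ cx'); by rewrite eqxx.
apply/subsetP => z zC'.
have [q [xq uxq lq]] := connect_uniq_path (connT x' z).
have zx' := avoidC _ _ _ cx' zC'.
(* Otherwise the tail of [q] from [x] on avoids [x'] and puts [x] into [C x' c']. *)
have xq' : x \notin q.
  apply: contraNN xC => xq'; move: (zC'); rewrite !inE => c'z.
  apply: (connect_trans c'z); rewrite connect_in_sym -lq.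
  move: xq uxq {lq}; case: (splitPr xq') => q1 q2.
  rewrite cat_path last_cat /= => /and3P[_ _ xq2].
  rewrite mem_cat inE => /andP[/norP[_ /norP[_ x'q2]] _].
  apply: path_in_connect => //; first by rewrite !inE eq_sym.
  by move=> w wq; rewrite !inE; apply: contraNneq x'q2 => <-.
rewrite inE; apply: (@connect_trans _ _ x'); first by rewrite connect_in_sym.
rewrite -lq; apply: path_in_connect => //; first by rewrite !inE.
by move=> w wq; rewrite !inE; apply: contraNneq xq' => <-.
Qed.

(** * Leafage *)

(** Used with [10 ^ a <= k]. The second bound starts at exponent 1, since at exponent 0 it would
    read [13 <= 8]; there [k > 1] helps instead. *)
Lemma exp10_bounds a : 3 * a <= 10 ^ a /\
  a.+2 * (2 * 4 ^ a.+2 + 5) <= 8 * 10 ^ a.+1.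
Proof.
elim: a => [|a [IH1 IH2]]; first by split.
split; first by rewrite expnS; have := expn_gt0 10 a; lia.
rewrite [4 ^ a.+3]expnS [10 ^ a.+2]expnS; move: IH2.
by set Y := 4 ^ a.+2; set X := 10 ^ a.+1; nia.
Qed.

(* [s] blocks of size [t], of which [b] will be chosen, while a subtree splits at
   most [q] blocks. Blocks of size 1 are never split, hence [q = 0] when
   [m <= a.+1]. *)
Lemma leaf_parameters k a m N :
    1 < k -> 10 ^ a <= k -> 0 < m -> 16 * k * m <= a.+1 * (2 * N + 1) ->
  exists s t b q : nat, [/\ 0 < t, s * t + k * t.-1 <= N, (t == 1) || (k <= q) &
    [/\ b <= (s - q)./2, s + 3 * b <= 4 * (s - q)./2 + 3, m <= b * t &
        2 * (m * 4 ^ b) + 4 * m <= N]].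
Proof.
move=> k_gt1 ak m_gt0 kmN.
have key : a.+1 * (2 * 4 ^ a.+1 + 5) <= 8 * k.
  case: a ak {kmN} => [|a] ak; first by rewrite expn1; lia.
  by have [_] := exp10_bounds a; lia.
have N_ge : m * (2 * 4 ^ a.+1 + 5) <= N.
  have : a.+1 * (2 * (m * (2 * 4 ^ a.+1 + 5))) <= a.+1 * (2 * N + 1).
    apply: leq_trans kmN; rewrite (_ : 16 * k * m = 2 * m * (8 * k)); last by lia.
    apply: leq_trans (leq_mul (leqnn (2 * m)) key); lia.
  rewrite leq_pmul2l //; lia.
have a3 : 3 * a <= k by have [+ _] := exp10_bounds a; lia.
have [ma|am] := leqP m a.+1.
  exists N, 1, m, 0; rewrite subn0.
  have := leq_pexp2l (isT : 0 < 4) ma.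
  have := expn_gt0 4 a.+1; have := odd_double_half N.
  by split; [| | |split]; nia.
(* The block size is [m / (a + 1)] rounded up. As [(s - q)./2 = k], the averaging condition
   [3k + 3(a + 1) <= 4k + 3] is [3a <= k]. *)
exists (3 * k), (m.-1 %/ a.+1).+1, a.+1, k.
have -> : (3 * k - k)./2 = k by lia.
have := divn_eq m.-1 a.+1; have := ltn_pmod m.-1 (ltn0Sn a).
set t := _ %/ _; set r := _ %% _ => ra mE.
split; [by []| |by rewrite leqnn orbT|].
  have : a.+1 * (4 * k * t.+1) <= a.+1 * N.
    (* Since [m > a + 1], rounding up costs less than a factor of 2. *)
    have : a.+1 * t.+1 + 2 <= 2 * m by nia.
    nia.
  rewrite leq_pmul2l //=; nia.
by split; nia.
Qed.

(** [V2] inherits the chains of the tree: [v] gets the chain and the depth of the top [y v] of its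
    subtree. *)
Lemma centre_biclique (G T : sgraph) (V1 V2 : {set G}) (S : G -> {set T})
    k a m N x :
    is_tree T -> #|leaves T| <= k -> (forall u, is_subtree (S u)) ->
    {in V1 & V2, forall u v, edge u v = (S u :&: S v != set0)} ->
    1 < k -> 10 ^ a <= k -> 0 < m -> 16 * k * m <= a.+1 * (2 * N + 1) ->
    N <= #|V1| -> N <= #|V2| -> #|V1| < #|[set u in V1 | x \in S u]| + 4 * m ->
  colorful_biclique V1 V2 m.
Proof.
move=> [[_ connT] acyclicT] leavesk treeS edgeE k_gt1 ak m_gt0 kmN NV1 NV2 popx.
have top v := subtree_top acyclicT connT x (treeS v).
have [y yP] := choice top.
have [c [K [cK Kk chain]]] := tree_chains acyclicT connT x.
have {leavesk}Kk : #|K| <= k.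
  by apply: leq_trans Kk _; rewrite geq_max leavesk (ltnW k_gt1).
have [s [t [b [q [t_gt0 stN tq [bq sb mbt mN]]]]]] := leaf_parameters k_gt1 ak m_gt0 kmN.
have edgey u v : u \in V1 -> v \in V2 -> x \in S u -> edge u v = (y v \in S u).
  move=> uV vV xu; rewrite edgeE //; have [yv ytop] := yP v.
  apply/idP/idP => [|yu]; first exact: ytop.
  by apply/set0Pn; exists (y v); rewrite inE yu.
apply: (@prefix_biclique G V1 V2 [set u in V1 | x \in S u] T (c \o y)
  (fun v => size (tree_path connT x (y v))) K s t b q m) => //.
- by apply/subsetP => u; rewrite inE => /andP[].
- by move=> v _; apply: cK.
- move=> u; rewrite inE => /andP[uV xu] v w vV wV cvw dvw.
  by rewrite !edgey //; apply: chain.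
- by apply: leq_trans (leq_trans stN NV2); rewrite leq_add2l leq_mul2r Kk orbT.
- by case/orP: tq => [->//|kq]; rewrite (leq_trans Kk kq) orbT.
- by move: NV1 popx mN; lia.
Qed.

Lemma leafage_biclique (G : sgraph) (V1 V2 : {set G}) k a m N :
    [disjoint V1 & V2] -> leafage_class k G ->
    1 < k -> 10 ^ a <= k -> 16 * k * m <= a.+1 * (2 * N + 1) ->
    N <= #|V1| -> N <= #|V2| ->
  colorful_biclique V1 V2 m.
Proof.
move=> V12 [chG]; rewrite /leafage; case: ex_minnP => l /asboolP.
move=> [T [treeT <- [S [treeS edgeS]]]] _ leavesk k_gt1 ak kmN NV1 NV2.
have [->|m_gt0] := posnP m.
  exact: colorful0.
have edgeE : {in V1 & V2, forall u v, edge u v = (S u :&: S v != set0)}.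
  move=> u v uV vV; apply: edgeS; apply: contraTneq vV => <-.
  by rewrite (disjointFr V12).
have [//|[x]|[x]] := popular_vertex treeT treeS edgeE m_gt0.
  exact: (centre_biclique treeT leavesk treeS edgeE k_gt1 ak m_gt0 kmN NV1 NV2).
move=> popx; apply: colorful_sym.
apply: (centre_biclique treeT leavesk treeS _ k_gt1 ak m_gt0 kmN NV2 NV1 popx).
by move=> u v uV vV; rewrite edge_sym edgeE // setIC.
Qed.

(** * Real constants and the theorem *)

Local Open Scope ring_scope.

(** [exp (1/6) >= 7/6] and [(7/6)^15 >= 10]. Since [40 = 16 * 5/2], this bound turns the constant
    [2 * 20] of the theorem into the 16 of [leaf_parameters]. *)
Lemma ln10_le (R : realType) : ln (10 : R) <= 5 / 2.
Proof.
rewrite -[leRHS]expRK ler_ln ?posrE ?expR_gt0 //.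
have -> : 5 / 2 = 15%:R * (1 / 6) :> R by lra.
rewrite expRM_natl.
apply: (@le_trans _ _ ((1 + 1 / 6) ^+ 15)); first by lra.
by apply: lerXn2r; rewrite ?nnegrE ?expR_ge0 ?expR_ge1Dx ?addr_ge0 ?divr_ge0.
Qed.

(* [Num.truncn] is the floor, as a natural number, of a nonnegative real. *)
Theorem theorem1p2 (R : realType) (G : sgraph) (V1 V2 : {set G})
    (V12_cover : V1 :|: V2 = [set: G])
    (V12_disj : [disjoint V1 & V2])
    (V1_card : #|V1| = uphalf #|G|)
    (V2_card : #|V2| = #|G|./2) :
  [/\ interval_graph R G ->
        colorful_biclique V1 V2
          (Num.truncn (1 / 3 * (#|G|%:R / 2) : R)),
      cograph G ->
        colorful_biclique V1 V2
          (Num.truncn (1 / 4 * (#|G|%:R / 2) : R)) &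
      forall k : nat, (2 <= k)%N -> leafage_class k G ->
        colorful_biclique V1 V2
          (Num.truncn (ln (k%:R : R) / (20 * k%:R) * (#|G|%:R / 2) : R))].
Proof.
have V1_ge : (#|G|./2 <= #|V1|)%N by rewrite V1_card uphalf_half leq_addl.
have V2_ge : (#|G|./2 <= #|V2|)%N by rewrite V2_card.
have cancel_nat (x y : nat) : (x%:R <= y%:R :> R) -> (x <= y)%N by rewrite ler_nat.
split=> [intG|coG|k k_ge2 leafG].
- set x := (_ * _ : R); have x_ge0 : 0 <= x by rewrite /x !mulr_ge0 ?invr_ge0.
  have := truncn_le x; rewrite x_ge0 => m_le.
  (* As [6m] is even, [3m <= n/2] survives rounding down. *)
  have : (6 * Num.truncn x <= #|G|)%N.
    by apply: cancel_nat; rewrite natrM; move: m_le; rewrite /x; lra.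
  by move=> m6; apply: (interval_biclique V12_disj intG); lia.
- set x := (_ * _ : R); have x_ge0 : 0 <= x by rewrite /x !mulr_ge0 ?invr_ge0.
  have := truncn_le x; rewrite x_ge0 => m_le.
  have : (8 * Num.truncn x <= #|G|)%N.
    by apply: cancel_nat; rewrite natrM; move: m_le; rewrite /x; lra.
  by move=> m8; apply: (cograph_biclique coG); lia.
set x := (_ * _ : R).
have k_gt0 : 0 < k%:R :> R by rewrite ltr0n; lia.
have ln_ge0k : 0 <= ln (k%:R : R) by rewrite ln_ge0 // ler1n; lia.
have x_ge0 : 0 <= x by rewrite /x !mulr_ge0 ?invr_ge0 ?mulr_ge0 // ltW.
have := truncn_le x; rewrite x_ge0 => m_le.
(* [a] is the decimal logarithm of [k] rounded down, so [ln k <= (a + 1) * ln 10]. *)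
have /andP[ak ka] := trunc_log_bounds (isT : (1 < 10)%N) (ltnW k_ge2).
move: ak ka; set a := trunc_log 10 k => ak ka.
have lnk : ln (k%:R : R) <= 5 / 2 * a.+1%:R.
  apply: (@le_trans _ _ (ln ((10 : R) ^+ a.+1))).
    by rewrite ler_ln ?posrE ?exprn_gt0 // -natrX ler_nat ltnW.
  by rewrite lnXn // -[_ *+ a.+1]mulr_natr ler_wpM2r // ln10_le.
have key : (16 * k * Num.truncn x <= a.+1 * #|G|)%N.
  apply: cancel_nat; rewrite !natrM.
  have m_le' : 40 * (k%:R * (Num.truncn x)%:R) <= ln (k%:R : R) * #|G|%:R.
    have -> : ln (k%:R : R) * #|G|%:R = 40 * (k%:R * x).
      by rewrite /x; field; rewrite gt_eqF.
    by rewrite ler_pM2l // ler_pM2l.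
  have : ln (k%:R : R) * #|G|%:R <= 5 / 2 * a.+1%:R * #|G|%:R.
    by rewrite ler_wpM2r.
  lra.
apply: (leafage_biclique V12_disj leafG k_ge2 ak _ V1_ge V2_ge).
by apply: leq_trans key _; rewrite leq_mul2l; apply/orP; right; lia.
Qed.
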